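(* The following two statements are equivalent. (i) (Pascal's Theorem) For every nondegenerate conic $X$ in $\mathbb{RP}^2$ and all points $a,b,c,d,e,f\in X$ (not necessarily distinct) such that $\overline{ab}\neq\overline{de}$, $\overline{bc}\neq\overline{ef}$ and $\overline{cd}\neq\overline{fa}$, the three points $\overline{ab}\cap\overline{de}$, $\overline{bc}\cap\overline{ef}$, $\overline{cd}\cap\overline{fa}$ are collinear. (ii) For every marked conic $(X,L,o)$, the induced binary operation $\oplus$ on $X_L$ is associative.
   Context: Everything takes place in the real projective plane $\mathbb{RP}^2$. For points $x,y$ on a conic $X$, $\overline{xy}$ denotes the line through $x$ and $y$ if $x\neq y$, and the tangent line to $X$ at $x$ if $x=y$; for distinct points not both on $X$ it is the line through them. A marked conic is a triple $(X,L,o)$ where $X$ is a nondegenerate conic in $\mathbb{RP}^2$, $L$ is a line in $\mathbb{RP}^2$, and $o$ is a point of $X$ not on $L$. Put $X_L:=X\setminus L$. The induced binary operation $\oplus$ on $X_L$ is: for $a,b\in X_L$, let $p$ be the point where $\overline{ab}$ meets $L$ (it does not lie on $X$); the line $\overline{op}$ meets $X$ in two points counted with multiplicity, one of which is $o$; $a\oplus b$ is the other one (so $a\oplus b=o$ if $\overline{op}$ is tangent to $X$ at $o$). *)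

(* Defs.v *)
From HB Require Import structures.
From mathcomp Require Import all_boot all_order all_algebra.
From mathcomp Require Import ring.
From mathcomp Require Import boolp classical_sets reals.

Set Implicit Arguments.
Unset Strict Implicit.
Unset Printing Implicit Defensive.

Import Order.TTheory GRing.Theory Num.Theory.
Local Open Scope ring_scope.

Definition bform (S : comNzRingType) (A : 'M[S]_3) (u v : 'rV[S]_3) : S :=
  (u *m A *m v^T) 0 0.

Section BilinearForm.
Variables (S : comNzRingType) (A : 'M[S]_3).
Implicit Types u v w : 'rV[S]_3.

Lemma bformDl u v w : bform A (u + v) w = bform A u w + bform A v w.
Proof. by rewrite /bform !mulmxDl [LHS]mxE. Qed.

Lemma bformDr u v w : bform A u (v + w) = bform A u v + bform A u w.
Proof. by rewrite /bform linearD mulmxDr [LHS]mxE. Qed.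

Lemma bformZl k u v : bform A (k *: u) v = k * bform A u v.
Proof. by rewrite /bform -!scalemxAl [LHS]mxE. Qed.

Lemma bformZr k u v : bform A u (k *: v) = k * bform A u v.
Proof. by rewrite /bform linearZ -scalemxAr [LHS]mxE. Qed.

End BilinearForm.

Section Plane.
Variable R : realType.
Local Notation V := 'rV[R]_3.

(* Points and lines of RP^2 are the 1- and 2-dimensional subspaces of R^3;
   incidence is inclusion (x <= l)%VS. *)
Record ppoint := PPoint {
  point_space :> {vspace V};
  point_dim : \dim point_space == 1%N }.

HB.instance Definition _ := [isSub for point_space].
HB.instance Definition _ := [Choice of ppoint by <:].

Record pline := PLine {
  line_space :> {vspace V};
  line_dim : \dim line_space == 2%N }.

HB.instance Definition _ := [isSub for line_space].
HB.instance Definition _ := [Choice of pline by <:].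

(* A choice of homogeneous coordinates. *)
Definition rep (x : ppoint) : V := vpick x.

(* A nondegenerate conic is given by an equation v A v^T = 0 with A symmetric
   and invertible.  Proportional matrices give the same conic.  Definite A give
   the empty point set. *)
Record conic := Conic {
  conic_mx :> 'M[R]_3;
  conic_sym : conic_mx^T = conic_mx;
  conic_unit : conic_mx \in unitmx }.

Definition on_conic (X : conic) (x : ppoint) : bool :=
  bform X (rep x) (rep x) == 0.

Definition collinear (x y z : ppoint) : Prop :=
  exists l : pline, [/\ (x <= l)%VS, (y <= l)%VS & (z <= l)%VS].

Lemma rep_mem (x : ppoint) : rep x \in (x : {vspace V}).
Proof. exact: memv_pick. Qed.

Lemma rep_neq0 (x : ppoint) : rep x != 0.
Proof. by rewrite vpick0 -dimv_eq0 (eqP (point_dim x)). Qed.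

Lemma point_vline (x : ppoint) : x = <[rep x]>%VS :> {vspace V}.
Proof.
apply/esym/eqP; rewrite eqEdim -memvE rep_mem /=.
by rewrite dim_vline rep_neq0 (eqP (point_dim x)).
Qed.

Lemma point_eq (x y : ppoint) : (x <= y)%VS -> x = y.
Proof.
move=> xy; apply/val_inj/eqP.
by rewrite /= eqEdim xy (eqP (point_dim x)) (eqP (point_dim y)).
Qed.

Lemma line_eq (l m : pline) : (l <= m)%VS -> l = m.
Proof.
move=> lm; apply/val_inj/eqP.
by rewrite /= eqEdim lm (eqP (line_dim l)) (eqP (line_dim m)).
Qed.

Lemma point_capv (x : ppoint) (U : {vspace V}) :
  ~~ (x <= U)%VS -> (x :&: U = 0)%VS.
Proof.
move=> xU; apply/eqP; rewrite -dimv_eq0.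
have /leqifP := dimv_leqif_sup (capvSl x U).
rewrite (eqP (point_dim x)) subv_cap subvv /= (negbTE xU).
by case: (\dim _).
Qed.

Lemma meet_dim (l m : pline) : l != m -> \dim (l :&: m)%VS == 1%N.
Proof.
move=> lm; have := dimv_sum_cap l m.
have le3 : (\dim (l + m)%VS <= 3)%N.
  by apply: leq_trans (dimvS (subvf _)) _; rewrite dimvf dim_matrix.
have lt1 : (\dim (l :&: m)%VS < 2)%N.
  have /leqifP := dimv_leqif_sup (capvSl l m).
  rewrite (eqP (line_dim l)) subv_cap subvv /=.
  by case: ifPn => // /line_eq E; rewrite E eqxx in lm.
rewrite (eqP (line_dim l)) (eqP (line_dim m)).
by move: le3 lt1; case: (\dim (l :&: m)%VS) => [|[]] // + _ /[!addn0] E; rewrite E.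
Qed.

Definition meet (l m : pline) (lm : l != m) : ppoint := PPoint (meet_dim lm).

Definition tangent_space (X : conic) (x : ppoint) : {vspace V} :=
  lker (linfun (mulmxr (X *m (rep x)^T)) : 'Hom(V, 'rV[R]_1)).

Lemma bformC (X : conic) u v : bform X u v = bform X v u.
Proof.
rewrite /bform -[u *m _ *m _]trmxK [in LHS]mxE.
by rewrite !trmx_mul trmxK conic_sym mulmxA.
Qed.

Lemma tangentE (X : conic) x v :
  (v \in tangent_space X x) = (bform X (rep x) v == 0).
Proof.
rewrite memv_ker lfunE /= bformC /bform mulmxA.
apply/eqP/eqP => [->|E]; first by rewrite mxE.
by apply/rowP => i; rewrite ord1 [RHS]mxE -E.
Qed.

Lemma tangent_dim (X : conic) x : \dim (tangent_space X x) == 2%N.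
Proof.
rewrite /tangent_space; set f := linfun _.
have := limg_ker_dim f fullv; rewrite capfv dimvf dim_matrix.
have le1 : (\dim (limg f) <= 1)%N.
  by apply: leq_trans (dimvS (subvf _)) _; rewrite dimvf dim_matrix.
suff: limg f != 0%VS.
  rewrite -dimv_eq0; move: le1; case: (\dim (limg f)) => [|[]] //= _ _.
  by rewrite addn1 => -[->].
apply/negP => /eqP f0; suff A0 : X *m (rep x)^T = 0.
  have := mulKmx (conic_unit X) (rep x)^T; rewrite A0 mulmx0 => /esym E.
  by have := rep_neq0 x; rewrite -[rep x]trmxK E trmx0 eqxx.
apply/row_matrixP => i; rewrite row0 rowE.
have : f (delta_mx 0 i) \in limg f by rewrite memv_img ?memvf.
by rewrite f0 memv0 lfunE /= => /eqP.
Qed.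

Lemma join_dim (x y : ppoint) : x != y -> \dim (x + y)%VS == 2%N.
Proof.
move=> xy; rewrite dimv_disjoint_sum ?(eqP (point_dim x)) ?(eqP (point_dim y)) //.
by apply: point_capv; apply: contraNN xy => /point_eq ->.
Qed.

Definition chord_space (X : conic) (x y : ppoint) : {vspace V} :=
  if x == y then tangent_space X x else (x + y)%VS.

Lemma chord_dim (X : conic) x y : \dim (chord_space X x y) == 2%N.
Proof.
rewrite /chord_space; case: (eqVneq x y) => [_|]; last exact: join_dim.
exact: tangent_dim.
Qed.

(* For x = y on X this is the tangent line at x, in the form of the polar of x.
   For x != y no incidence with X is assumed. *)
Definition chord (X : conic) (x y : ppoint) : pline := PLine (chord_dim X x y).

(* Multiplicity of x in the intersection of l and X: with v spanning x and
   v, w spanning l, the order of vanishing at t = 0 of the equation of X at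
   v + t w. *)
Definition imult (X : conic) (l : pline) (x : ppoint) : nat :=
  if (x <= l)%VS then
    mup 0 (let v := map_mx polyC (rep x) in
           let w := map_mx polyC (vpick (l :\: x)%VS) in
           bform (map_mx polyC X) (v + 'X *: w) (v + 'X *: w))
  else 0%N.

(* y and z are the intersections of l and X, counted with multiplicity. *)
Definition meets_twice (X : conic) (l : pline) (y z : ppoint) : Prop :=
  forall x : ppoint, imult X l x = ((x == y) + (x == z))%N.

Record marked_conic := MarkedConic {
  mconic :> conic;
  mline : pline;
  mpoint : ppoint;
  mpoint_on : on_conic mconic mpoint;
  mpoint_off : ~~ (mpoint <= mline)%VS }.

(* The points of the conic that are not on the marked line. *)
Record affine_conic (M : marked_conic) := Affine {
  affine_point :> ppoint;
  affineP : on_conic M affine_point && ~~ (affine_point <= mline M)%VS }.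

HB.instance Definition _ M := [isSub for @affine_point M].
HB.instance Definition _ M := [Choice of affine_conic M by <:].

Lemma chordl (X : conic) (x y : ppoint) : on_conic X x -> (x <= chord X x y)%VS.
Proof.
move=> Xx; rewrite /= /chord_space; case: eqP => _; last exact: addvSl.
by rewrite {1}point_vline -memvE tangentE.
Qed.

Lemma bform_eq0 (X : conic) (x : ppoint) (v : V) :
  v \in (x : {vspace V}) -> v != 0 -> (bform X v v == 0) = on_conic X x.
Proof.
rewrite /on_conic point_vline => /vlineP[k ->].
rewrite scaler_eq0 negb_or => /andP[k0 _].
by rewrite bformZl bformZr !mulf_eq0 (negbTE k0).
Qed.

Lemma bform_lin (X : conic) (v w : V) (a b c d : R) :
  bform X (a *: v + b *: w) (c *: v + d *: w) =
  a * c * bform X v v + (a * d + b * c) * bform X v w + b * d * bform X w w.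
Proof.
by rewrite !(bformDl, bformDr, bformZl, bformZr) [bform X w v]bformC; ring.
Qed.

Local Notation dir l x := (vpick ((l : {vspace V}) :\: (x : {vspace V}))%VS).

Lemma dir_mem (l : pline) (x : ppoint) : dir l x \in (l : {vspace V}).
Proof. exact: (subvP (diffvSl _ _)) (memv_pick _). Qed.

Lemma dir_span (l : pline) (x : ppoint) : (x <= l)%VS ->
  forall u, u \in (l : {vspace V}) ->
  exists a b, u = a *: rep x + b *: dir l x.
Proof.
move=> xl u ul; suff E : l = (<[rep x]> + <[dir l x]>)%VS :> {vspace V}.
  move: ul; rewrite {1}E => /memv_addP[_ /vlineP[a ->] [_ /vlineP[b ->] ->]].
  by exists a, b.
have := dimv_cap_compl l x.
rewrite (capv_idPr xl) (eqP (point_dim x)) (eqP (line_dim l)) => -[] /[!add0n] d1.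
rewrite -(point_vline x).
have -> : <[dir l x]>%VS = (l :\: x)%VS.
  apply/eqP; rewrite eqEdim -memvE memv_pick /= dim_vline d1.
  by rewrite vpick0 -dimv_eq0 d1.
by rewrite -{1}(addv_diff_cap l x) (capv_idPr xl) addvC.
Qed.

Lemma imultE (X : conic) (l : pline) (x : ppoint) : (x <= l)%VS ->
  imult X l x =
  mup 0 ((bform X (rep x) (rep x))%:P
         + 'X * ((2 * bform X (rep x) (dir l x))%:P
                 + 'X * (bform X (dir l x) (dir l x))%:P)).
Proof.
move=> xl; rewrite /imult xl /=; congr (mup 0 _).
set v := rep x; set w := dir l x.
have E u u' : bform (map_mx polyC X) (map_mx polyC u) (map_mx polyC u')
              = (bform X u u')%:P.
  by rewrite /bform map_trmx -!map_mxM [LHS]mxE.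
rewrite !(bformDl, bformDr, bformZl, bformZr) !E [bform X w v]bformC.
by rewrite polyCM polyC_natr; ring.
Qed.

Lemma imult0 (X : conic) (l : pline) (x : ppoint) :
  ~~ on_conic X x -> imult X l x = 0%N.
Proof.
move=> Xx; case: (boolP (x <= l)%VS) => [xl|]; last by rewrite /imult => /negbTE->.
by rewrite imultE // mupNroot // rootE !hornerE /=.
Qed.

Lemma imult1 (X : conic) (l : pline) (x : ppoint) : (x <= l)%VS ->
  on_conic X x -> bform X (rep x) (dir l x) != 0 -> imult X l x = 1%N.
Proof.
move=> xl /eqP Xx B; rewrite imultE // Xx add0r mulrC mupMr.
  by rewrite -['X]subr0 -polyC0 -['X - _]expr1 mup_XsubCX eqxx.
by rewrite rootE !hornerE /= mulf_neq0 ?pnatr_eq0.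
Qed.

Lemma imult2 (X : conic) (l : pline) (x : ppoint) : (x <= l)%VS ->
  on_conic X x -> bform X (rep x) (dir l x) = 0 ->
  bform X (dir l x) (dir l x) != 0 -> imult X l x = 2%N.
Proof.
move=> xl /eqP Xx B C; rewrite imultE // Xx add0r B mulr0 add0r mulrA mulrC mupMr.
  by rewrite -['X]subr0 -polyC0 -expr2 mup_XsubCX eqxx.
by rewrite rootE !hornerE /=.
Qed.

Lemma conic_line_free (X : conic) (l : pline) :
  ~ (forall u v, u \in (l : {vspace V}) -> v \in (l : {vspace V}) ->
     bform X u v = 0).
Proof.
move=> H; pose B : 'M[R]_(_, 3) := \matrix_(i < \dim l) (vbasis l)`_i.
have rB : \rank B = 2%N.
  rewrite -[RHS](eqP (line_dim l)); apply/eqP; rewrite -/(row_free B).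
  apply/inj_row_free => w wB.
  have /freeP fr := basis_free (vbasisP l).
  apply/rowP => i; rewrite mxE; apply: (fr (fun i => w 0 i)).
  apply: etrans wB; rewrite mulmx_sum_row; apply: eq_bigr => j _.
  by rewrite rowK.
have /mulmx0_rank_max : (B *m X) *m B^T = 0.
  apply/matrixP => i j; have := H (vbasis l)`_i (vbasis l)`_j.
  rewrite !vbasis_mem ?mem_nth ?size_tuple // => /(_ isT isT) E.
  have rowB (k : 'I__) : (vbasis l)`_k = row k B by rewrite rowK.
  rewrite [RHS]mxE -[RHS]E /bform !rowB tr_row -!row_mul colE mulmxA -colE.
  by rewrite [RHS]mxE [RHS]mxE.
by rewrite mxrank_tr mxrankMfree ?rB // row_free_unit conic_unit.
Qed.

Lemma chord_meets (X : conic) (a b x : ppoint) :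
  on_conic X a -> on_conic X b -> on_conic X x -> (x <= chord X a b)%VS ->
  (x == a) || (x == b).
Proof.
move=> Xa Xb Xx xl; apply: contraT; rewrite negb_or => /andP[xa xb].
have al := chordl b Xa.
have [u [ul ua Bu]] : exists u, [/\ u \in (chord X a b : {vspace V}),
    u \notin (a : {vspace V}) & bform X (rep a) u = 0 /\ bform X u u = 0].
  move: xl; rewrite /= /chord_space; case: eqVneq => [ab|ab] xl.
    exists (rep x); rewrite (subvP xl) ?rep_mem //; split=> //.
      by apply: contraNN xa; rewrite memvE -point_vline => /point_eq ->.
    split; last exact/eqP.
    by apply/eqP; rewrite -tangentE (subvP xl) ?rep_mem.
  exists (rep b); split.
  - by rewrite (subvP (addvSr _ _)) ?rep_mem.
  - by apply: contraNN ab; rewrite memvE -point_vline => /point_eq ->.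
  split; last exact/eqP.
  have := subvP xl _ (rep_mem x); rewrite {1}(point_vline a) {1}(point_vline b).
  case/memv_addP => _ /vlineP[s ->] [_ /vlineP[t ->] E].
  move: Xx; rewrite /on_conic E bform_lin (eqP Xa) (eqP Xb) !mulr0 add0r addr0.
  rewrite [t * s]mulrC -mulr2n !mulf_eq0 mulrn_eq0 /= mulf_eq0 -orbA.
  case/or3P => [/eqP s0|/eqP t0|/eqP//].
  - move: E; rewrite s0 scale0r add0r => E; case/negP: xb.
    apply/eqP/point_eq; rewrite {1}point_vline E -memvE memvZ ?rep_mem //.
  - move: E; rewrite t0 scale0r addr0 => E; case/negP: xa.
    apply/eqP/point_eq; rewrite {1}point_vline E -memvE memvZ ?rep_mem //.
case: Bu => B Q; exfalso; apply: (@conic_line_free X (chord X a b)) => y z.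
have [s [t Eu]] := dir_span al ul.
have t0 : t != 0.
  by apply: contraNneq ua => t0; rewrite Eu t0 scale0r addr0 memvZ ?rep_mem.
have D : dir (chord X a b) a = (- (s / t)) *: rep a + t^-1 *: u.
  rewrite Eu scalerDr !scalerA mulVf // scale1r addrA -scalerDl.
  by rewrite [t^-1 * s]mulrC addNr scale0r add0r.
have sp y' : y' \in (chord X a b : {vspace V}) -> exists p q, y' = p *: rep a + q *: u.
  move=> /(dir_span al)[p [q ->]]; rewrite D scalerDr !scalerA addrA -scalerDl.
  by do 2!eexists.
move=> /sp[p [q ->]] /sp[p' [q' ->]].
by rewrite bform_lin B Q (eqP Xa); ring.
Qed.

Section Operation.
Variable M : marked_conic.

Lemma origin_subproof : on_conic M (mpoint M) && ~~ (mpoint M <= mline M)%VS.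
Proof. by rewrite mpoint_on mpoint_off. Qed.

Definition origin : affine_conic M := Affine origin_subproof.

Lemma chord_neq (a b : affine_conic M) : chord M a b != mline M.
Proof.
have /andP[Xa aL] := affineP a.
by apply: contraNneq aL => <-; exact: chordl.
Qed.

Definition chord_point (a b : affine_conic M) : ppoint := meet (chord_neq a b).

(* The default value of xget is never used, see oplusP. *)
Definition oplus (a b : affine_conic M) : affine_conic M :=
  xget origin
    [set c : affine_conic M |
      meets_twice M (chord M origin (chord_point a b)) origin c]%classic.

Lemma chord_point_off (a b : affine_conic M) : ~~ on_conic M (chord_point a b).
Proof.
have /andP[Xa aL] := affineP a; have /andP[Xb bL] := affineP b.
have pL : (chord_point a b <= mline M)%VS := capvSr _ _.
apply/negP => Xp; have := chord_meets Xa Xb Xp (capvSl _ _).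
by case/orP => /eqP E; rewrite E ?(negbTE aL) ?(negbTE bL) in pL.
Qed.

Lemma meets_twice_uniq (X : conic) (l : pline) (x y z : ppoint) :
  meets_twice X l x y -> meets_twice X l x z -> y = z.
Proof.
move=> Hy Hz; have := Hy y; rewrite Hz eqxx => /eqP.
by rewrite eqn_add2l eqb1 => /eqP.
Qed.

Lemma second_point (X : conic) (l : pline) (x p : ppoint) :
  on_conic X x -> (x <= l)%VS -> (p <= l)%VS -> ~~ on_conic X p ->
  exists2 c : ppoint, on_conic X c /\ (c <= l)%VS & meets_twice X l x c.
Proof.
move=> Xx xl pl Xp; set v := rep x; set w := dir l x.
set B := bform X v w; set C := bform X w w.
have q0 : bform X v v = 0 by exact/eqP.
have BC : ~~ ((B == 0) && (C == 0)).
  apply: contra Xp => /andP[/eqP B0 /eqP C0].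
  have [s [t E]] := dir_span xl (subvP pl _ (rep_mem p)).
  by rewrite /on_conic E bform_lin -/B -/C B0 C0 q0; apply/eqP; ring.
have wx : w \notin (x : {vspace V}).
  rewrite {1}point_vline; apply/negP => /vlineP[k E].
  by case/negP: BC; rewrite /B /C E !(bformZl, bformZr) -/v q0 !mulr0 eqxx.
have onl (y : ppoint) : (y <= l)%VS -> y != x ->
    exists s t, t != 0 /\ rep y = s *: v + t *: w.
  move=> yl yx; have [s [t E]] := dir_span xl (subvP yl _ (rep_mem y)).
  exists s, t; split => //; apply: contraNneq yx => t0; apply/eqP/point_eq.
  by rewrite {1}point_vline E t0 scale0r addr0 -memvE memvZ ?rep_mem.
case: (eqVneq B 0) => [B0|B0].
  have C0 : C != 0 by move: BC; rewrite B0 eqxx.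
  exists x; first by [].
  move=> y; case: (eqVneq y x) => [->|yx]; first by rewrite imult2.
  case: (boolP (y <= l)%VS) => [yl|]; last by rewrite /imult => /negbTE->.
  rewrite imult0 //; have [s [t [t0 E]]] := onl y yl yx.
  rewrite /on_conic E bform_lin q0 -/B -/C B0 !mulr0 !add0r.
  by rewrite !mulf_neq0.
pose u := C *: v + (- (2 * B)) *: w.
have B2 : 2 * B != 0 by rewrite mulf_neq0 ?pnatr_eq0.
have ux : u \notin (x : {vspace V}).
  apply: contraNN wx => ux; have vx : v \in (x : {vspace V}) := rep_mem x.
  have E : w = (- (2 * B))^-1 *: (u - C *: v).
    by rewrite /u [C *: v + _]addrC addrK scalerA mulVf ?oppr_eq0 // scale1r.
  by rewrite E; apply: memvZ; apply: memvB => //; apply: memvZ.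
have u0 : u != 0 by apply: contraNneq ux => ->; rewrite mem0v.
have ud : \dim <[u]> == 1%N by rewrite dim_vline u0.
pose c := PPoint ud.
have uc : u \in (c : {vspace V}) by rewrite /= memv_line.
have ul : u \in (l : {vspace V}).
  apply: memvD; apply: memvZ; last exact: dir_mem.
  exact: (subvP xl) (rep_mem x).
have cl : (c <= l)%VS by rewrite /= -memvE.
have Xc : on_conic X c.
  by rewrite -(bform_eq0 X uc u0) /u bform_lin q0 -/B -/C; apply/eqP; ring.
have xc : x != c by apply: contraNneq ux => ->.
exists c => // y; case: (eqVneq y x) => [->|yx].
  by rewrite (negbTE xc) imult1.
case: (boolP (y <= l)%VS) => [yl|yl]; last first.
  rewrite /imult (negbTE yl); case: eqP => // E.
  by rewrite E cl in yl.
case: (eqVneq y c) => [->|yc]; last first.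
  rewrite imult0 //; apply: contraNN yc; have [s [t [t0 E]]] := onl y yl yx.
  rewrite /on_conic E bform_lin q0 -/B -/C => /eqP H.
  have {}H : t * (s * (2 * B) + t * C) = 0 by rewrite -[RHS]H; ring.
  move/eqP: H; rewrite mulf_eq0 (negbTE t0) /= => /eqP H.
  apply/eqP/point_eq; rewrite {1}point_vline /= -memvE E.
  apply/vlineP; exists (- (t / (2 * B))).
  rewrite /u scalerDr !scalerA mulrNN divfK //; congr (_ *: _ + _).
  apply: (mulIf B2); rewrite mulrAC mulNr mulfVK //.
  by rewrite mulNr; apply/eqP; rewrite -addr_eq0; apply/eqP.
rewrite imult1 //.
apply/negP => /eqP H.
have rc0 : bform X (rep c) (rep c) = 0 by exact/eqP.
have [a [b E]] := dir_span cl (subvP xl _ (rep_mem x)).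
have /vlineP[k Ek] : rep c \in <[u]>%VS by exact: (rep_mem c).
have : bform X (rep c) v = 0.
  by rewrite /v E bformDr !bformZr rc0 H !mulr0 addr0.
rewrite Ek /u bformZl bformDl !bformZl q0 bformC -/B mulr0 add0r => /eqP.
rewrite !(mulf_eq0 k) mulf_eq0 oppr_eq0 (negbTE B0) (negbTE B2) !orbF => /eqP k0.
by move: (rep_neq0 c); rewrite Ek k0 scale0r eqxx.
Qed.

Lemma oplusP (a b : affine_conic M) :
  meets_twice M (chord M origin (chord_point a b)) origin (oplus a b).
Proof.
have Xo : on_conic M origin by exact: mpoint_on.
have oL : ~~ (origin <= mline M)%VS by exact: mpoint_off.
set l := chord _ _ _; have ol : (origin <= l)%VS by exact: chordl.
have Xp := chord_point_off a b.
have op : affine_point origin != chord_point a b.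
  by apply: contraNneq Xp => <-.
have pl : (chord_point a b <= l)%VS.
  by rewrite /= /chord_space (negbTE op) addvSr.
have [c [Xc cl] H] := second_point Xo ol pl Xp.
suff cL : ~~ (c <= mline M)%VS.
  have cP : on_conic M c && ~~ (c <= mline M)%VS by rewrite Xc cL.
  exact: (@xgetPex _ _ [set c : affine_conic M | meets_twice M l origin c]%classic
    (ex_intro _ (Affine cP) H)).
apply: contraNN Xp => cL.
have lL : l != mline M by apply: contraNneq oL => <-.
have -> // : chord_point a b = c.
transitivity (meet lL).
  by apply: point_eq; rewrite subv_cap pl /= capvSr.
by apply/esym/point_eq; rewrite subv_cap cl.
Qed.

End Operation.

End Plane.

(* Main.v *)
Require Import Defs.
From mathcomp Require Import all_boot all_order all_algebra.
From mathcomp Require Import boolp classical_sets reals.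

Set Implicit Arguments.
Unset Strict Implicit.
Unset Printing Implicit Defensive.

(** Both implications are synthetic.  They rest on one description of the
    operation: a (+) b is the point c for which the line ab, the line oc and
    the marked line L are concurrent ([oplus_chord], [oplus_eq]).

    Pascal implies associativity: put x = a (+) b and y = b (+) c and consider
    the hexagon o x c b a y.  The opposite sides ox, ba meet on L and so do
    cb, yo; by Pascal xc and ay meet on L as well, and x (+) c and a (+) y,
    being determined by those meeting points, agree.  Pascal applies and
    identifies L unless two opposite sides coincide or the two points on L do.
    If ox = ba or cb = yo, one of a, b, c is o, which is neutral; if xc = ay,
    nothing is left to prove; if the two points on L coincide, a = c and
    commutativity suffices.

    Associativity implies Pascal: let p, q, r be the meets of the pairs ab, de;
    bc, ef; cd, fa of sides of the hexagon a b c d e f.  If p, r are distinct and off X and no vertex lies on the line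
    L = pr, mark X with L and o = a.  Then e (+) d = b and d (+) c = f, so
    associativity gives b (+) c = e (+) f, which says that bc and ef meet on L.
    If some vertex lies on L, two sides of the hexagon coincide with L and q is
    a vertex on L ([pascal_off]).  If p and r lie on X, they are vertices, and
    collinearity is seen from the incidences alone ([pascal_on]).  Since among
    p, q, r two are off X or two are on X, rotating the hexagon reduces the
    general case to these two. *)

(** * Incidence of points and lines *)

Section Incidence.
Variable R : realType.
Implicit Types (x y z : ppoint R) (l m : pline R).

Lemma line_unique x y l m : x != y ->
  (x <= l)%VS -> (y <= l)%VS -> (x <= m)%VS -> (y <= m)%VS -> l = m.
Proof.
move=> xy xl yl xm ym; pose j := PLine (join_dim xy).
have jl : j = l by apply: line_eq; rewrite /= subv_add xl.
by rewrite -jl; apply: line_eq; rewrite /= subv_add xm.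
Qed.

Lemma meet_unique x y l m : l != m ->
  (x <= l)%VS -> (y <= l)%VS -> (x <= m)%VS -> (y <= m)%VS -> x = y.
Proof.
move=> lm xl yl xm ym; apply/eqP; apply: contraNT lm => xy.
exact/eqP/(line_unique xy).
Qed.

Lemma collinear_rot x y z : collinear x y z -> collinear y z x.
Proof. by case=> l [xl yl zl]; exists l. Qed.

(** The line [l] serves the case where all three points coincide. *)
Lemma collinear_dup x z l : (x <= l)%VS -> collinear x x z.
Proof.
move=> xl; case: (eqVneq x z) => [<-|xz]; first by exists l.
by exists (PLine (join_dim xz)); split; rewrite /= ?addvSl ?addvSr.
Qed.

End Incidence.

(** * Chords of a conic *)

Section Chords.
Variables (R : realType) (X : conic R).
Implicit Types (a b c x y : ppoint R) (l : pline R).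

Lemma chordC a b : chord X a b = chord X b a.
Proof.
apply: val_inj; rewrite /= /chord_space eq_sym.
by case: eqVneq => [->|_] //; rewrite addvC.
Qed.

Lemma chordr a b : on_conic X b -> (b <= chord X a b)%VS.
Proof. by rewrite chordC; apply: chordl. Qed.

Lemma chord_cancel a b c : on_conic X a -> on_conic X b -> on_conic X c ->
  chord X a b = chord X a c -> b = c.
Proof.
move=> Xa Xb Xc E.
have bl : (b <= chord X a c)%VS by rewrite -E chordr.
case/orP: (chord_meets Xa Xc Xb bl) => /eqP // ba.
have cl : (c <= chord X a a)%VS by rewrite -{2}ba E chordr.
by case/orP: (chord_meets Xa Xa Xc cl) => /eqP ->.
Qed.

(** When [x] and [y] coincide, the multiplicity 2 of [x] forces [l] into the
    tangent at [x], because a transversal line meets [X] simply there. *)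
Lemma meets_twice_chord l x y :
  on_conic X x -> meets_twice X l x y -> l = chord X x y.
Proof.
move=> Xx H.
have mem z : (z == x) || (z == y) -> (z <= l)%VS.
  by move=> zxy; have := H z; rewrite /imult; case: ifP => // _; case: eqP zxy;
     case: eqP.
have xl : (x <= l)%VS by rewrite mem ?eqxx.
have yl : (y <= l)%VS by rewrite mem ?eqxx ?orbT.
case: (eqVneq x y) H => [<-|xy] H; last first.
  apply/esym/line_eq; rewrite /= /chord_space (negbTE xy) subv_add xl.
  exact: yl.
set w := vpick (l :\: x)%VS.
have B : bform X (rep x) w = 0%R.
  apply/eqP; apply/negPn/negP => B.
  by have := H x; rewrite (imult1 xl Xx B) eqxx.
apply: line_eq; rewrite /= /chord_space eqxx; apply/subvP => u ul.
have [s [t ->]] := dir_span xl ul.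
rewrite tangentE bformDr !bformZr -/w B (eqP Xx) !GRing.mulr0 GRing.addr0.
by [].
Qed.

End Chords.

(** * The induced operation *)

Section Oplus.
Variables (R : realType) (M : marked_conic R).
Implicit Types a b c d : affine_conic M.
Local Notation o := (origin M).

Lemma affine_on a : on_conic M a.
Proof. by case/andP: (affineP a). Qed.

Lemma chord_point_chord a b : (chord_point a b <= chord M a b)%VS.
Proof. exact: capvSl. Qed.

Lemma chord_point_line a b : (chord_point a b <= mline M)%VS.
Proof. exact: capvSr. Qed.

Lemma chord_point_eq a b (p : ppoint R) :
  (p <= chord M a b)%VS -> (p <= mline M)%VS -> chord_point a b = p.
Proof. by move=> pl pL; apply/esym/point_eq; rewrite subv_cap pl. Qed.

Lemma chord_point_neq a b (x : ppoint R) : on_conic M x -> x != chord_point a b.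
Proof. by move=> Xx; apply: contraNneq (chord_point_off a b) => <-. Qed.

Lemma chord_point_join a b :
  chord M o (chord_point a b) = chord M o (oplus a b).
Proof. exact: meets_twice_chord (affine_on o) (oplusP a b). Qed.

Lemma oplus_chord a b : (chord_point a b <= chord M o (oplus a b))%VS.
Proof.
rewrite -chord_point_join /= /chord_space.
by rewrite (negbTE (chord_point_neq a b (affine_on o))) addvSr.
Qed.

Lemma oplus_eq a b c : (chord_point a b <= chord M o c)%VS -> oplus a b = c.
Proof.
move=> pc; apply: val_inj.
apply: (chord_cancel (affine_on o)); rewrite ?affine_on //.
apply: (line_unique (chord_point_neq a b (affine_on o))) => //.
- exact/chordl/affine_on.
- exact: oplus_chord.
- exact/chordl/affine_on.
Qed.

Lemma eq_oplus a b c d : chord_point a b = chord_point c d -> oplus a b = oplus c d.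
Proof. by rewrite /oplus => ->. Qed.

Lemma oplus_chord_point a b c d :
  oplus a b = oplus c d -> chord_point a b = chord_point c d.
Proof.
move=> E; apply: (meet_unique (chord_neq o (oplus a b))).
- exact: oplus_chord.
- by rewrite E oplus_chord.
- exact: chord_point_line.
- exact: chord_point_line.
Qed.

Lemma oplusC : commutative (@oplus R M).
Proof.
move=> a b; apply/eq_oplus/chord_point_eq; last exact: chord_point_line.
by rewrite chordC chord_point_chord.
Qed.

Lemma oplus0l : left_id o (@oplus R M).
Proof. by move=> a; apply/oplus_eq/chord_point_chord. Qed.

Lemma oplus0r : right_id o (@oplus R M).
Proof. by move=> a; rewrite oplusC oplus0l. Qed.

(** A line joining [b] to a point off the conic has only one further
    intersection with the conic. *)
Lemma chord_point_inj a b c : chord_point a b = chord_point b c -> a = c.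
Proof.
move=> E; apply: val_inj.
apply: (chord_cancel (affine_on b)); rewrite ?affine_on //.
apply: (line_unique (chord_point_neq a b (affine_on b))).
- exact/chordl/affine_on.
- by rewrite chordC chord_point_chord.
- exact/chordl/affine_on.
- by rewrite E chord_point_chord.
Qed.

(** Keeps opposite sides through the origin distinct in [pascal_oplusA]. *)
Lemma chord_o_neq a b c : a != o -> b != o -> chord M o c != chord M a b.
Proof.
move=> ao bo; apply/negP => /eqP E.
have ol : (o <= chord M a b)%VS by rewrite -E chordl ?affine_on.
case/orP: (chord_meets (affine_on a) (affine_on b) (affine_on o) ol) => /eqP H.
- by case/eqP: ao; apply/esym/val_inj.
- by case/eqP: bo; apply/esym/val_inj.
Qed.

End Oplus.

(** * From Pascal's theorem to associativity *)

Definition pascal (R : realType) : Prop :=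
  forall (X : conic R) (a b c d e f : ppoint R),
     on_conic X a -> on_conic X b -> on_conic X c ->
     on_conic X d -> on_conic X e -> on_conic X f ->
     forall (abde : chord X a b != chord X d e)
            (bcef : chord X b c != chord X e f)
            (cdfa : chord X c d != chord X f a),
     collinear (meet abde) (meet bcef) (meet cdfa).

Lemma pascal_oplusA (R : realType) (M : marked_conic R) :
  pascal R -> associative (@oplus R M).
Proof.
move=> P a b c.
case: (eqVneq a (origin M)) => [->|ao]; first by rewrite !oplus0l.
case: (eqVneq b (origin M)) => [->|bo]; first by rewrite oplus0l oplus0r.
case: (eqVneq c (origin M)) => [->|co]; first by rewrite !oplus0r.
set x := oplus a b; set y := oplus b c.
case: (eqVneq (chord M x c) (chord M a y)) => [E|xcay].
  apply/eq_oplus/chord_point_eq; last exact: chord_point_line.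
  by rewrite -E chord_point_chord.
have oxba := chord_o_neq x bo ao.
have cbyo : chord M c b != chord M y (origin M).
  by rewrite eq_sym (chordC M y) chord_o_neq.
have := P M _ _ _ _ _ _ (affine_on (origin M)) (affine_on x) (affine_on c)
  (affine_on b) (affine_on a) (affine_on y) oxba xcay cbyo.
have <- : chord_point a b = meet oxba.
  apply: (meet_unique oxba); rewrite ?capvSl ?capvSr ?oplus_chord //.
  by rewrite (chordC M b) chord_point_chord.
have <- : chord_point b c = meet cbyo.
  apply: (meet_unique cbyo); rewrite ?capvSl ?capvSr //.
    by rewrite (chordC M c) chord_point_chord.
  by rewrite (chordC M y) oplus_chord.
case: (eqVneq (chord_point a b) (chord_point b c)) => [/chord_point_inj E|pr].
  by move=> _; rewrite /x /y E oplusC (oplusC c b).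
case=> l [pl ql rl].
have El : l = mline M by apply: (line_unique pr); rewrite ?chord_point_line.
rewrite El in ql; apply: eq_oplus.
rewrite (chord_point_eq (p := meet xcay)) ?capvSr //.
by rewrite (chord_point_eq (p := meet xcay)) ?capvSl.
Qed.

(** * From associativity to Pascal's theorem *)

(** The meets enter through incidences rather than [meet], so that the hexagon
    can be rotated without transporting the proofs that [meet] carries. *)
Record hexagon (R : realType) (X : conic R) (a b c d e f p q r : ppoint R) :
    Prop := Hexagon {
  hexa : on_conic X a; hexb : on_conic X b; hexc : on_conic X c;
  hexd : on_conic X d; hexe : on_conic X e; hexf : on_conic X f;
  hex_abde : chord X a b != chord X d e;
  hex_bcef : chord X b c != chord X e f;
  hex_cdfa : chord X c d != chord X f a;
  hex_pab : (p <= chord X a b)%VS; hex_pde : (p <= chord X d e)%VS;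
  hex_qbc : (q <= chord X b c)%VS; hex_qef : (q <= chord X e f)%VS;
  hex_rcd : (r <= chord X c d)%VS; hex_rfa : (r <= chord X f a)%VS }.

Lemma hexagon_rot (R : realType) (X : conic R) (a b c d e f p q r : ppoint R) :
  hexagon X a b c d e f p q r -> hexagon X b c d e f a q r p.
Proof. by case=> *; split=> //; rewrite eq_sym. Qed.

Section Pascal.
Variables (R : realType) (X : conic R) (a b c d e f p q r : ppoint R).
Hypothesis H : hexagon X a b c d e f p q r.

(** A meet on [X] is a vertex common to two opposite sides.  However the
    vertices coincide, either two of the meets agree or one side of the hexagon
    passes through all three. *)
Lemma pascal_on : on_conic X p -> on_conic X r -> collinear p q r.
Proof.
case: H => Xa Xb Xc Xd Xe Xf abde bcef cdfa pab pde qbc qef rcd rfa Xp Xr.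
have pr_case : p = r -> collinear p q r.
  by move=> <-; apply/collinear_rot/(collinear_dup _ pab).
have pq_case : p = q -> collinear p q r.
  by move=> <-; apply: collinear_dup pab.
have qr_case : q = r -> collinear p q r.
  by move=> <-; apply/collinear_rot/collinear_rot/(collinear_dup _ qbc).
case/orP: (chord_meets Xa Xb Xp pab) => /eqP pE;
  case/orP: (chord_meets Xd Xe Xp pde) => /eqP pE'.
- (* p = a = d *)
  apply: pr_case; apply: (meet_unique cdfa) => //.
    by rewrite pE' chordr.
  by rewrite pE chordr.
- (* p = a = e *)
  case/orP: (chord_meets Xc Xd Xr rcd) => /eqP rE;
    case/orP: (chord_meets Xf Xa Xr rfa) => /eqP rE'.
  + apply: qr_case; apply: (meet_unique bcef) => //.
      by rewrite rE chordr.
    by rewrite rE' chordr.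
  + by apply: pr_case; rewrite pE.
  + exists (chord X e f); split=> //; first by rewrite pE' chordl.
    by rewrite rE' chordr.
  + by apply: pr_case; rewrite pE.
- (* p = b = d *)
  case/orP: (chord_meets Xc Xd Xr rcd) => /eqP rE.
  + exists (chord X b c); split=> //; first by rewrite pE chordl.
    by rewrite rE chordr.
  + by apply: pr_case; rewrite pE'.
- (* p = b = e *)
  apply: pq_case; apply: (meet_unique bcef) => //.
    by rewrite pE chordl.
  by rewrite pE' chordl.
Qed.

Hypothesis assoc : forall M : marked_conic R, associative (@oplus R M).

Lemma pascal_off : ~~ on_conic X p -> ~~ on_conic X r -> collinear p q r.
Proof.
case: H => Xa Xb Xc Xd Xe Xf abde bcef cdfa pab pde qbc qef rcd rfa Xp Xr.
case: (eqVneq p r) => [<-|pr].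
  exact/collinear_rot/(collinear_dup _ pab).
pose L := PLine (join_dim pr).
have pL : (p <= L)%VS := addvSl _ _.
have rL : (r <= L)%VS := addvSr _ _.
suff qL : (q <= L)%VS by exists L.
have side (x s z : ppoint R) (l : pline R) :
    on_conic X x -> ~~ on_conic X s -> (x <= L)%VS -> (s <= L)%VS ->
    (x <= l)%VS -> (s <= l)%VS -> (z <= l)%VS -> l = L /\ (z <= L)%VS.
  move=> Xx Xs xL sL xl sl zl.
  have xs : x != s by apply: contraNneq Xs => <-.
  by have E : l = L := line_unique xs xl sl xL sL; rewrite -E.
case: (boolP (a <= L)%VS) => [aL|aL].
  (* The sides ab and fa both equal L, so b = f, and q is this vertex. *)
  have [E1 bL] := side _ _ _ _ Xa Xp aL pL (chordl b Xa) pab (chordr a Xb).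
  have [E2 _] := side _ _ _ _ Xa Xr aL rL (chordr f Xa) rfa (chordr f Xa).
  have bf : b = f.
    by apply: (chord_cancel Xa) => //; rewrite E1 -E2 chordC.
  suff -> : q = b by [].
  apply: (meet_unique bcef) => //; first exact: chordl.
  by rewrite bf chordr.
case: (boolP (d <= L)%VS) => [dL|dL].
  (* The sides de and cd both equal L, so c = e, and q is this vertex. *)
  have [E1 eL] := side _ _ _ _ Xd Xp dL pL (chordl e Xd) pde (chordr d Xe).
  have [E2 _] := side _ _ _ _ Xd Xr dL rL (chordr c Xd) rcd (chordr c Xd).
  have ce : e = c.
    by apply: (chord_cancel Xd) => //; rewrite E1 -E2 chordC.
  suff -> : q = e by [].
  apply: (meet_unique bcef) => //; last exact: chordl.
  by rewrite ce chordr.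
(* If b were on L, the side ab would equal L and a would be on L too; the same
   holds for f, and for c and e with d in the place of a. *)
have bL : ~~ (b <= L)%VS.
  apply: contraNN aL => bL.
  exact: (proj2 (side _ _ _ _ Xb Xp bL pL (chordr a Xb) pab (chordl b Xa))).
have eL : ~~ (e <= L)%VS.
  apply: contraNN dL => eL.
  exact: (proj2 (side _ _ _ _ Xe Xp eL pL (chordr d Xe) pde (chordl e Xd))).
have cL : ~~ (c <= L)%VS.
  apply: contraNN dL => cL.
  exact: (proj2 (side _ _ _ _ Xc Xr cL rL (chordl d Xc) rcd (chordr c Xd))).
have fL : ~~ (f <= L)%VS.
  apply: contraNN aL => fL.
  exact: (proj2 (side _ _ _ _ Xf Xr fL rL (chordl a Xf) rfa (chordr f Xa))).
pose M := MarkedConic Xa aL.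
have aff x : on_conic X x -> ~~ (x <= L)%VS ->
    {x' : affine_conic M | affine_point x' = x}.
  move=> Xx xL.
  have xP : on_conic M x && ~~ (x <= mline M)%VS by apply/andP.
  by exists (Affine xP).
have [b' Eb] := aff b Xb bL; have [c' Ec] := aff c Xc cL.
have [d' Ed] := aff d Xd dL; have [e' Ee] := aff e Xe eL.
have [f' Ef] := aff f Xf fL.
have edb : oplus e' d' = b'.
  apply: oplus_eq; rewrite (chord_point_eq (p := p)).
  - by rewrite Eb.
  - by rewrite Ee Ed chordC.
  - exact: pL.
have dcf : oplus d' c' = f'.
  apply: oplus_eq; rewrite (chord_point_eq (p := r)).
  - by rewrite Ef chordC.
  - by rewrite Ed Ec chordC.
  - exact: rL.
have bcef' : oplus b' c' = oplus e' f' by rewrite -edb -dcf assoc.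
have E := oplus_chord_point bcef'.
suff -> : q = chord_point b' c' by exact: chord_point_line.
apply: (meet_unique bcef) => //.
  by have := chord_point_chord b' c'; rewrite Eb Ec.
by rewrite E; have := chord_point_chord e' f'; rewrite Ee Ef.
Qed.

End Pascal.

Lemma oplusA_pascal (R : realType) :
  (forall M : marked_conic R, associative (@oplus R M)) -> pascal R.
Proof.
move=> assoc X a b c d e f Xa Xb Xc Xd Xe Xf abde bcef cdfa.
have H : hexagon X a b c d e f (meet abde) (meet bcef) (meet cdfa).
  by split; rewrite ?capvSl ?capvSr.
have H1 := hexagon_rot H; have H2 := hexagon_rot H1.
move: (meet abde) (meet bcef) (meet cdfa) H H1 H2 => p q r H H1 H2.
have [Xp|Xp] := boolP (on_conic X p); have [Xr|Xr] := boolP (on_conic X r).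
- exact: pascal_on H Xp Xr.
- have [Xq|Xq] := boolP (on_conic X q).
  + exact/collinear_rot/collinear_rot/(pascal_on H1 Xq Xp).
  + exact/collinear_rot/(pascal_off H2 assoc Xr Xq).
- have [Xq|Xq] := boolP (on_conic X q).
  + exact/collinear_rot/(pascal_on H2 Xr Xq).
  + exact/collinear_rot/collinear_rot/(pascal_off H1 assoc Xq Xp).
- exact: pascal_off H assoc Xp Xr.
Qed.

Theorem mainTheorem2 (R : realType) :
  (forall (X : conic R) (a b c d e f : ppoint R),
     on_conic X a -> on_conic X b -> on_conic X c ->
     on_conic X d -> on_conic X e -> on_conic X f ->
     forall (abde : chord X a b != chord X d e)
            (bcef : chord X b c != chord X e f)
            (cdfa : chord X c d != chord X f a),
     collinear (meet abde) (meet bcef) (meet cdfa))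
  <->
  (forall M : marked_conic R, associative (@oplus R M)).
Proof.
by split=> [P M|A]; [exact: pascal_oplusA | exact: oplusA_pascal].
Qed.
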